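(* Let $G$ be a Garside group with Garside element $\Delta$, let $\Delta^m$ be the minimal positive central power of $\Delta$, and let $g\in G$ be a nonidentity $p/q$-periodic element. For an integer $r$, the following are equivalent: (1) $g^r$ is slim and $\langle\bar g\rangle=\langle\bar g^r\rangle$ in $G_\Delta$; (2) $pr\equiv1\bmod q$ and $r$ is coprime to $\frac{m}{p\wedge m}$. In particular, such an integer $r$ exists.
   Context: Garside groups. In a monoid $M$, an atom is an element $a\neq 1$ such that $a=bc$ implies $b=1$ or $c=1$; $\Vert a\Vert$ is the supremum of the lengths of expressions of $a$ as products of atoms. $M$ is atomic if it is generated by its atoms and $\Vert a\Vert<\infty$ for all $a\in M$. Put $a\le_L b$ if $ac=b$ for some $c\in M$, and $a\le_R b$ if $ca=b$ for some $c\in M$. A Garside monoid is an atomic, left and right cancellative monoid $M$ such that $(M,\le_L)$ and $(M,\le_R)$ are lattices and $M$ contains a Garside element $\Delta$, i.e. an element such that for each $a\in M$, $a\le_L\Delta$ iff $a\le_R\Delta$, and the set $[1,\Delta]=\{a\in M: 1\le_L a\le_L\Delta\}$ is finite and generates $M$. A Garside group $G$ with Garside element $\Delta$ is the group of fractions of a Garside monoid $M$ with Garside element $\Delta$; $M$ is identified with its image in $G$. Some positive power of $\Delta$ is always central; $m$ is the smallest positive integer such that $\Delta^m$ is central in $G$. $G_\Delta=G/\langle\Delta^m\rangle$, and $\bar g$ is the image of $g\in G$ in $G_\Delta$. $p\wedge m$ is the greatest common divisor. An element $g\in G$ is $p/q$-periodic ($p\in\mathbb Z$, $q\in\mathbb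 Z_{\ge1}$) if $g^q$ is conjugate to $\Delta^p$ and $q$ is the smallest positive integer such that $g^q$ is conjugate to a power of $\Delta$. A $p/q$-periodic element is slim if $p\equiv1\bmod q$. *)

(* Defs.v *)
From HB Require Import structures.
From mathcomp Require Import all_boot all_order all_algebra.
From mathcomp Require Import boolp classical_sets cardinality.

Set Implicit Arguments.
Unset Strict Implicit.
Unset Printing Implicit Defensive.

Local Open Scope classical_set_scope.
Local Open Scope group_scope.

Section Groups.
Variable G : groupType.
Implicit Types (x y z : G) (N : set G).

Definition zexpg x (n : int) : G :=
  match n with
  | Posz k => x ^+ k
  | Negz k => x ^- k.+1
  end.

Definition cyclic_subgroup x : set G := [set y | exists n : int, y = zexpg x n].

Definition conjugate x y : Prop := exists h : G, y = x ^ h.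

Definition central z : Prop := forall x, commute z x.

Definition normal_subgroup N : Prop :=
  [/\ N 1,
      forall x y, N x -> N y -> N (x * y),
      forall x, N x -> N x^-1
    & forall x y, N x -> N (x ^ y)].

Lemma zexpgV x (n : int) : (zexpg x n)^-1 = zexpg x (- n)%R.
Proof. by case: n => [[|k]|k] /=; rewrite ?invg1 ?invgK. Qed.

Lemma zexpgS x (n : int) : zexpg x (n + 1)%R = zexpg x n * x.
Proof.
case: n => [k|k]; first by rewrite -PoszD addn1 [LHS]expgSr.
case: k => [|k]; first by rewrite mulVg.
have -> : (Negz k.+1 + 1)%R = Negz k.
  by rewrite !NegzE -[k.+2]addn1 PoszD GRing.opprD GRing.subrK.
by rewrite /= (expgS x k.+1) invgM mulgVK.
Qed.

Lemma zexpgB1 x (n : int) : zexpg x (n - 1)%R = zexpg x n * x^-1.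
Proof. by rewrite -{2}(GRing.subrK 1%R n) zexpgS mulgK. Qed.

Lemma zexpgD x (n k : int) : zexpg x (n + k)%R = zexpg x n * zexpg x k.
Proof.
elim/int_rect: k => [|k IH|k IH]; first by rewrite GRing.addr0 mulg1.
  by rewrite -addn1 PoszD GRing.addrA !zexpgS IH mulgA.
by rewrite -addn1 PoszD GRing.opprD GRing.addrA !zexpgB1 IH mulgA.
Qed.

Lemma cyclic_central_normal z :
  central z -> normal_subgroup (cyclic_subgroup z).
Proof.
move=> zC; split; first by exists 0%R.
- by move=> _ _ [n ->] [k ->]; exists (n + k)%R; rewrite zexpgD.
- by move=> _ [n ->]; exists (- n)%R; rewrite zexpgV.
move=> _ y [n ->]; exists n.
have powC k : z ^+ k * y = y * z ^+ k by apply/commute_sym/commuteX/esym/zC.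
rewrite /conjg; case: n => k /=; first by rewrite powC mulKg.
apply: (mulgI y); rewrite mulVKg; apply: (mulgI (z ^+ k.+1)).
by rewrite mulVKg mulgA powC mulgK.
Qed.

End Groups.

Section Quotient.
Variables (G : groupType) (N : set G) (nN : normal_subgroup N).

Definition coset_eq (x y : G) : bool := `[< N (x^-1 * y) >].

Lemma coset_eq_equiv : equiv_class_of coset_eq.
Proof.
case: nN => N1 NM NV _; split=> [x|x y|y x t].
- by apply/asboolP; rewrite mulVg.
- by apply/asboolP/asboolP=> /NV; rewrite invgM invgK.
move=> /asboolP Nxy /asboolP Nyt; apply/asboolP.
by have := NM _ _ Nxy Nyt; rewrite -mulgA mulVKg.
Qed.

Canonical coset_eq_rel := EquivRelPack coset_eq_equiv.

Definition group_quot := {eq_quot coset_eq_rel}%qT.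
HB.instance Definition _ := Choice.on group_quot.

Definition quot_pi (x : G) : group_quot := (\pi_({eq_quot coset_eq_rel}) x)%qT.

Definition quot_one : group_quot := quot_pi 1.
Definition quot_mul (a b : group_quot) : group_quot :=
  quot_pi (repr a * repr b).
Definition quot_inv (a : group_quot) : group_quot := quot_pi (repr a)^-1.

Lemma quot_piP x y : quot_pi x = quot_pi y <-> N (x^-1 * y).
Proof.
split=> [/eqP|Nxy]; first by rewrite eqmodE => /asboolP.
by apply/eqP; rewrite eqmodE; apply/asboolP.
Qed.

Lemma quot_piK (a : group_quot) : quot_pi (repr a) = a.
Proof. exact: reprK. Qed.

Lemma quot_piM x y : quot_pi (x * y) = quot_mul (quot_pi x) (quot_pi y).
Proof.
case: nN => _ NM _ NJ; apply/quot_piP.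
have /quot_piP Nx := esym (quot_piK (quot_pi x)).
have /quot_piP Ny := esym (quot_piK (quot_pi y)).
have := NM _ _ (NJ _ y Nx) Ny.
by rewrite /conjg invgM !mulgA mulgK.
Qed.

Lemma quot_piV x : quot_pi x^-1 = quot_inv (quot_pi x).
Proof.
case: nN => _ _ NV NJ; apply/quot_piP.
have /quot_piP Nx := quot_piK (quot_pi x).
by have := NJ _ (repr (quot_pi x))^-1 Nx; rewrite /conjg !invgK -mulgA mulVKg.
Qed.

Lemma quot_mulA : associative quot_mul.
Proof.
move=> a b c; rewrite -(quot_piK a) -(quot_piK b) -(quot_piK c).
by rewrite -!quot_piM mulgA.
Qed.

Lemma quot_mul1 : left_id quot_one quot_mul.
Proof. by move=> a; rewrite -(quot_piK a) -quot_piM mul1g. Qed.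

Lemma quot_mulr1 : right_id quot_one quot_mul.
Proof. by move=> a; rewrite -(quot_piK a) -quot_piM mulg1. Qed.

Lemma quot_mulV : left_inverse quot_one quot_inv quot_mul.
Proof. by move=> a; rewrite -(quot_piK a) -quot_piV -quot_piM mulVg. Qed.

Lemma quot_mulrV : right_inverse quot_one quot_inv quot_mul.
Proof. by move=> a; rewrite -(quot_piK a) -quot_piV -quot_piM mulgV. Qed.

HB.instance Definition _ := isGroup.Build group_quot
  quot_mulA quot_mul1 quot_mulr1 quot_mulV quot_mulrV.

End Quotient.

Section Monoids.
Variable M : monoidType.
Implicit Types (a b c d : M) (A : set M).

Definition generates A : Prop :=
  forall a, exists2 s : seq M, {in s, forall x, A x} & \prod_(x <- s) x = a.

Definition atom a : Prop :=
  a <> 1 /\ forall b c, a = b * c -> b = 1 \/ c = 1.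

(* ||a|| < oo, with ||a|| the supremum of the lengths [size s]. *)
Definition finite_norm a : Prop :=
  exists n : nat, forall s : seq M,
    {in s, forall x, atom x} -> \prod_(x <- s) x = a -> size s <= n.

Definition atomic : Prop := generates atom /\ forall a, finite_norm a.

Definition left_cancellative : Prop :=
  forall a b c, a * b = a * c -> b = c.
Definition right_cancellative : Prop :=
  forall a b c, b * a = c * a -> b = c.

Definition le_L a b : Prop := exists c, a * c = b.
Definition le_R a b : Prop := exists c, c * a = b.

Definition is_lattice (le : M -> M -> Prop) : Prop :=
  [/\ forall a, le a a,
      forall a b, le a b -> le b a -> a = b,
      forall a b c, le a b -> le b c -> le a c,
      forall a b, exists d,
        [/\ le d a, le d b & forall c, le c a -> le c b -> le c d]
    & forall a b, exists d,
        [/\ le a d, le b d & forall c, le a c -> le b c -> le d c]].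

Definition simple_elements (Delta : M) : set M :=
  [set a | le_L 1 a /\ le_L a Delta].

Definition garside_element (Delta : M) : Prop :=
  [/\ forall a, le_L a Delta <-> le_R a Delta,
      finite_set (simple_elements Delta)
    & generates (simple_elements Delta)].

Definition garside_monoid (Delta : M) : Prop :=
  [/\ atomic,
      left_cancellative /\ right_cancellative,
      is_lattice le_L /\ is_lattice le_R
    & garside_element Delta].

End Monoids.

(* [iota] is the identification of [M] with its image in [G]. *)
Definition group_of_fractions (M : monoidType) (G : groupType)
    (iota : UMagmaMorphism.type M G) : Prop :=
  injective iota /\ forall g : G, exists a b : M, g = (iota a)^-1 * iota b.

Definition garside_group (G : groupType) (Delta : G) : Prop :=
  exists (M : monoidType) (Delta0 : M)
         (iota : UMagmaMorphism.type M G),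
    [/\ garside_monoid Delta0, group_of_fractions iota & Delta = iota Delta0].

Section PeriodicElements.
Variables (G : groupType) (Delta : G).

Record minimal_central_power (m : nat) : Prop := MinimalCentralPower {
  mcp_gt0 : 0 < m;
  mcp_central : central (Delta ^+ m);
  mcp_min : forall k : nat, 0 < k -> central (Delta ^+ k) -> m <= k
}.

Definition G_Delta (m : nat) (mP : minimal_central_power m) : groupType :=
  group_quot (cyclic_central_normal (mcp_central mP)).

Definition bar (m : nat) (mP : minimal_central_power m) (g : G) : G_Delta mP :=
  quot_pi (cyclic_central_normal (mcp_central mP)) g.

Definition periodic (g : G) (p : int) (q : nat) : Prop :=
  [/\ 0 < q,
      conjugate (g ^+ q) (zexpg Delta p)
    & forall k : nat, 0 < k ->
        (exists n : int, conjugate (g ^+ k) (zexpg Delta n)) -> q <= k].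

Definition slim (g : G) : Prop :=
  exists (p : int) (q : nat), periodic g p q /\ (p = 1 %[mod q])%Z.

End PeriodicElements.

(* Main.v *)
(* If h^k = D^k with D = Delta^n and k > 0, then x |-> h x D^-1 is an
   automorphism of the lattice (G, <=_L) under which 1 has a finite orbit; the
   join x of this orbit satisfies h x = x D, so h is conjugate to D. Hence
   Delta has infinite order, p and q are coprime, and g^k is conjugate to
   Delta^n exactly when n q = p k. It follows that the image of g in G_Delta
   has order N = q m / gcd(p, m), so g and g^r generate the same subgroup there
   iff r is coprime to N, and that g^r is (p r)/q-periodic when r is coprime to
   q. A suitable r is obtained from an inverse r0 of p mod q as r0 + q t, where
   t is the part of m / gcd(p, m) prime to r0. *)
Require Import Defs.
From mathcomp Require Import all_boot all_order all_algebra.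
From mathcomp Require Import classical_sets.

Set Implicit Arguments.
Unset Strict Implicit.
Unset Printing Implicit Defensive.

Import GRing.Theory.

(** * Coprime representatives of a residue class *)

(** Take for [t] the largest divisor of [d] prime to [r]. A prime factor of [d] divides exactly one
    of [r] and [q * t]: if it divides [r] it divides neither [q] nor [t], and otherwise it divides
    [t]. *)
Lemma coprime_lift (r q d : nat) : 0 < r -> 0 < d -> coprime r q ->
  exists t, coprime (r + q * t) d.
Proof.
move=> r_gt0 d_gt0 rq; exists d`_(\pi(r)^'); set t := d`_(_).
have rqt : coprime r (q * t).
  by rewrite coprimeMr rq (pnat_coprime (pnat_pi r_gt0)) ?part_pnat.
apply: contraT => ncop; pose l := pdiv (gcdn (r + q * t) d).
have l_pr : prime l by rewrite pdiv_prime // ltn_neqAle eq_sym ncop gcdn_gt0 d_gt0 orbT.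
have /andP[l_s l_d] : (l %| r + q * t) && (l %| d) by rewrite -dvdn_gcd pdiv_dvd.
have [l_r|l_r] := boolP (l %| r).
  have : l %| gcdn r (q * t) by rewrite dvdn_gcd l_r -(dvdn_addr _ l_r).
  by rewrite (eqP rqt) Euclid_dvd1.
have : l %| d`_(\pi(r)) * t by rewrite partnC.
rewrite Euclid_dvdM // => /orP[l_p|l_t].
  have : l \in \pi(r) by apply: (pnatP _ _ (part_pnat _ d)).
  by rewrite mem_primes (negPf l_r) !andbF.
by move: l_s; rewrite dvdn_addl ?(negPf l_r) // dvdn_mull.
Qed.

Lemma coprime_inverse_mod (p : int) (q d : nat) :
    (0 < q)%N -> (0 < d)%N -> coprimez p q ->
  exists r : int, (p * r = 1 %[mod q])%Z /\ coprimez r d.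
Proof.
move=> q_gt0 d_gt0 /coprimezP[[u v] /= uv].
have q0 : (q : int) != 0%R by rewrite -lt0n.
(* The extra [q] makes [r0] positive even if the residue of [u] is 0. *)
pose r0 := (`|(u %% q)%Z| + q)%N.
have pr0 : (p * r0 = 1 %[mod q])%Z.
  rewrite PoszD gez0_abs ?modz_ge0 // mulrDr -modzDmr modzMl addr0.
  rewrite modzMmr -uv -[in RHS]modzDmr modzMl addr0 mulrC //.
have r0q : coprime r0 q.
  have /eqP : (p * r0 = 1 %[mod q])%Z by [].
  rewrite eqz_mod_dvd => /dvdzP[w wE].
  apply/(coprimezP r0 q); exists (p, - w)%R => /=.
  by rewrite mulNr -wE opprB addrC subrK.
have [t rd] := @coprime_lift r0 q d (ltn_addl _ q_gt0) d_gt0 r0q.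
exists (r0 + q * t)%N; split=> //.
by rewrite PoszD PoszM mulrDr mulrCA -modzDmr modzMr addr0.
Qed.

Local Open Scope group_scope.

(** * Fixed points of order automorphisms *)

(** The map [f] permutes the finite orbit of [x], so it fixes the join [y] of that orbit;
    monotonicity of the inverse [f'] is what bounds [f y] by [y]. *)
Lemma iter_fixpoint (T : Type) (le : T -> T -> Prop) (f f' : T -> T)
    (x : T) (k : nat) :
    (forall a b c, le a b -> le b c -> le a c) ->
    (forall a b, le a b -> le b a -> a = b) ->
    (forall a, le a a) ->
    (forall a b, exists d,
      [/\ le a d, le b d & forall c, le a c -> le b c -> le d c]) ->
    {homo f : a b / le a b} -> {homo f' : a b / le a b} ->
    cancel f f' -> cancel f' f ->
    0 < k -> iter k f x = x ->
  exists y, f y = y.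
Proof.
move=> leT leA leR join fM f'M fK f'K k_gt0 fkx.
have [y [yub ylub]] : exists y, (forall i, i < k -> le (iter i f x) y) /\
    forall c, (forall i, i < k -> le (iter i f x) c) -> le y c.
  case: k k_gt0 {fkx} => // k _; elim: k => [|k [y [yub ylub]]].
    by exists x; split=> [[|i] // _|c ub]; last exact: (ub 0).
  have [d [yd kd dlub]] := join y (iter k.+1 f x); exists d; split=> [i|c ub].
    by rewrite ltnS leq_eqVlt => /predU1P[->//|/yub iy]; apply: leT yd.
  by apply: dlub; [apply: ylub => i ik; apply/ub/ltnW | apply: ub].
have yub' i : le (iter i f x) y.
  rewrite (divn_eq i k) addnC iterD.
  have -> n : iter (n * k) f x = x by elim: n => // n IH; rewrite mulSn iterD IH.
  by apply/yub/ltn_pmod.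
exists y; apply: leA.
  rewrite -[y in le _ y]f'K; apply/fM/ylub => i _.
  by rewrite -[iter i f x]fK; apply/f'M/(yub' i.+1).
(* For [i = 0] the orbit closes up: [f' x] is the iterate of index [k.-1]. *)
apply: ylub => i _; rewrite -[iter i f x]f'K; apply: fM; case: i => [|i] /=.
  by rewrite -fkx -(prednK k_gt0) /= fK; apply: yub'.
by rewrite fK; apply: yub'.
Qed.

(** * Integer powers and conjugation *)

Section IntegerPowers.
Variable G : groupType.
Implicit Types x y z h : G.

Lemma zexpgM x (a b : int) : zexpg x (a * b)%R = zexpg (zexpg x a) b.
Proof.
elim/int_rect: b => [|b IH|b IH]; first by rewrite mulr0.
  by rewrite -addn1 PoszD mulrDr mulr1 !zexpgD IH.
by rewrite -addn1 PoszD opprD mulrDr mulrN1 !zexpgD IH -(zexpgV x a).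
Qed.

Lemma zexpgJ x h (n : int) : zexpg x n ^ h = zexpg (x ^ h) n.
Proof. by case: n => n /=; rewrite ?conjVg conjXg. Qed.

Lemma conjugate_zexpg x y (n : int) :
  conjugate x y -> conjugate (zexpg x n) (zexpg y n).
Proof. by case=> h ->; exists h; rewrite zexpgJ. Qed.

Lemma conjugate_central x z : central z -> conjugate x z -> x = z.
Proof.
move=> zC [h zE]; rewrite -(conjgK h x) -zE /conjg zC.
by rewrite mulKg.
Qed.

Lemma central_zexpg z (n : int) : central z -> central (zexpg z n).
Proof.
move=> zC x; case: n => n /=; apply/commute_sym; last apply: commuteV.
  exact/commuteX/commute_sym/zC.
exact/commuteX/commute_sym/zC.
Qed.

Lemma cyclic_subgroup_zexpgP x (r : int) :
  cyclic_subgroup x = cyclic_subgroup (zexpg x r) <->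
  exists s : int, x = zexpg x (r * s)%R.
Proof.
split=> [E|[s xE]].
  have : cyclic_subgroup x x by exists 1%R.
  by rewrite {1}E => -[s xE]; exists s; rewrite zexpgM.
apply/seteqP; split=> y [n ->]; last by exists (r * n)%R; rewrite zexpgM.
by exists (s * n)%R; rewrite -zexpgM mulrA zexpgM -xE.
Qed.

End IntegerPowers.

(** * The lattice order on a Garside group *)

Section Garside.
Variables (M : monoidType) (Delta0 : M) (G : groupType).
Variable iota : UMagmaMorphism.type M G.
Hypotheses (gM : garside_monoid Delta0) (fracG : group_of_fractions iota).
Notation Delta := (iota Delta0).

(** Extension of [le_L] to the group of fractions, invariant under left translation. *)
Definition le_frac (x y : G) : Prop := exists c, x^-1 * y = iota c.

Lemma le_frac_refl x : le_frac x x.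
Proof. by exists 1; rewrite mulVg gmulf1. Qed.

Lemma le_frac_trans x y z : le_frac x y -> le_frac y z -> le_frac x z.
Proof.
move=> [c cE] [d dE]; exists (c * d).
by rewrite gmulfM -cE -dE -mulgA mulVKg.
Qed.

Lemma le_frac_anti x y : le_frac x y -> le_frac y x -> x = y.
Proof.
case: gM fracG => _ _ [[_ anti _ _ _] _] _ [iI _] [c cE] [d dE].
have cd : c * d = 1.
  by apply: iI; rewrite gmulfM gmulf1 -cE -dE -mulgA mulVKg mulVg.
(* Antisymmetry of [le_L] leaves 1 as the only unit of [M]. *)
have c1 : c = 1 by apply: anti; [exists d | exists c; rewrite mul1g].
by apply: (mulgI x^-1); rewrite cE c1 gmulf1 mulVg.
Qed.

Lemma le_frac_mull h x y : le_frac x y -> le_frac (h * x) (h * y).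
Proof. by case=> c cE; exists c; rewrite invgM -mulgA mulKg. Qed.

(* A common left denominator [iota (u * x)] moves both elements into [M], where the lattice join is also the join in [G]. *)
Lemma le_frac_join x y : exists d,
  [/\ le_frac x d, le_frac y d
    & forall c, le_frac x c -> le_frac y c -> le_frac d c].
Proof.
case: gM fracG => _ _ [[_ _ _ _ joinL] [_ _ _ _ joinR]] _ [iI frac].
have [a [b xE]] := frac x; have [a' [b' yE]] := frac y.
have [e [[u ue] [v ve] _]] := joinR a a'.
have [f [[s sf] [t tf] flub]] := joinL (u * b) (v * b').
have xE' : x = (iota e)^-1 * iota (u * b).
  by rewrite xE -ue !gmulfM invgM mulgA mulgVK.
have yE' : y = (iota e)^-1 * iota (v * b').
  by rewrite yE -ve !gmulfM invgM mulgA mulgVK.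
exists ((iota e)^-1 * iota f); split.
- by rewrite xE'; apply: le_frac_mull; exists s; rewrite -sf (gmulfM (u * b)) mulKg.
- by rewrite yE'; apply: le_frac_mull; exists t; rewrite -tf (gmulfM (v * b')) mulKg.
move=> c [i iE] [j jE].
have iE' : iota (u * b * i) = iota e * c.
  by rewrite gmulfM -iE xE' invgM invgK !mulgA mulgV mul1g.
have jE' : iota (v * b' * j) = iota e * c.
  by rewrite gmulfM -jE yE' invgM invgK !mulgA mulgV mul1g.
have [||k kE] := flub (u * b * i); first by exists i.
  by exists j; apply: iI; rewrite jE' iE'.
by exists k; rewrite invgM invgK -mulgA -iE' -kE gmulfM mulKg.
Qed.

Lemma conj_stable_simple (h : G) :
    (forall s, simple_elements Delta0 s -> exists b, iota s ^ h = iota b) ->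
  forall a, exists b, iota a ^ h = iota b.
Proof.
case: gM => _ _ _ [_ _ gen] simple_h a; have [s sS <-] := gen a.
elim: s sS => [|x s IH] sS; first by exists 1; rewrite big_nil gmulf1 conj1g.
have [|b bE] := IH; first by move=> y ys; apply: sS; rewrite inE ys orbT.
have [c cE] := simple_h x (sS x (mem_head _ _)).
by exists (c * b); rewrite big_cons !gmulfM conjMg bE cE.
Qed.

(** For simple [x] with [x * c = Delta0], the right divisor [c] is also a left divisor,
    [c * d = Delta0], and conjugation by [Delta] sends [x] to [d]. *)
Lemma Delta_conj_stable a : exists b, iota a ^ Delta = iota b.
Proof.
case: gM => _ _ _ [LR _ _]; apply: conj_stable_simple => x [_ [c xc]].
have [d cd] : le_L c Delta0 by apply/LR; exists x.
by exists d; rewrite /conjg -{2}cd -xc !gmulfM invgM -!mulgA !mulKg.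
Qed.

Lemma DeltaV_conj_stable a : exists b, iota a ^ Delta^-1 = iota b.
Proof.
case: gM => _ _ _ [LR _ _]; apply: conj_stable_simple => x [_ xL].
have [c cx] : le_R x Delta0 by apply/LR.
have [d dc] : le_R c Delta0 by apply/LR; exists x.
by exists d; rewrite /conjg invgK mulgA -{1}dc -cx !gmulfM invgM !mulgA !mulgK.
Qed.

Lemma zexpg_Delta_conj_stable (n : int) a :
  exists b, iota a ^ zexpg Delta n = iota b.
Proof.
elim/int_rect: n => [|n [b bE]|n [b bE]]; first by exists a; rewrite conjg1.
  have [c cE] := Delta_conj_stable b; exists c.
  by rewrite -addn1 PoszD zexpgS conjgM bE.
have [c cE] := DeltaV_conj_stable b; exists c.
by rewrite -addn1 PoszD opprD zexpgB1 conjgM bE.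
Qed.

(** Right multiplication by a power of [Delta] only conjugates [x^-1 * y] by it, which preserves
    [M]. *)
Lemma le_frac_mulr_Delta (n : int) x y :
  le_frac x y -> le_frac (x * zexpg Delta n) (y * zexpg Delta n).
Proof.
move=> [c cE]; have [d dE] := zexpg_Delta_conj_stable n c; exists d.
by rewrite -dE -cE /conjg invgM !mulgA.
Qed.

Lemma root_of_Delta_power_eq h (n : int) (k : nat) :
  0 < k -> h ^+ k = zexpg Delta n ^+ k -> conjugate h (zexpg Delta n).
Proof.
move=> k_gt0 hk; set D := zexpg Delta n.
have DV : D^-1 = zexpg Delta (- n)%R by rewrite zexpgV.
have [||||||y yE] := @iter_fixpoint G le_frac (fun x => h * x * D^-1)
  (fun x => h^-1 * x * D) 1 k le_frac_trans le_frac_anti le_frac_refl le_frac_join => //.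
- by move=> x y xy; rewrite DV; apply/le_frac_mulr_Delta/le_frac_mull.
- by move=> x y xy; apply/le_frac_mulr_Delta/le_frac_mull.
- by move=> x; rewrite mulgA mulgVK mulKg.
- by move=> x; rewrite mulgA mulgK mulVKg.
(* The orbit of 1 consists of the elements [h ^+ i * D ^- i], so the hypothesis on [k]-th powers
   closes it. *)
- have -> i : iter i (fun x => h * x * D^-1) 1 = h ^+ i * D ^- i.
    elim: i => [|i IH]; first by rewrite mul1g invg1.
    by rewrite iterS IH (expgS h) (expgS D) invgM !mulgA.
  by rewrite hk mulgV.
by exists y; rewrite /conjg -[h * y](mulgVK D) yE mulKg.
Qed.

Lemma conjugate_Delta_root h (n : int) (k : nat) :
    0 < k -> conjugate (h ^+ k) (zexpg Delta (n * k)%R) ->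
  conjugate h (zexpg Delta n).
Proof.
move=> k_gt0 [c cE].
have [|d dE] := @root_of_Delta_power_eq (h ^ c) n k k_gt0.
  by rewrite -conjXg -cE zexpgM.
by exists (c * d); rewrite conjgM.
Qed.

(** Otherwise [Delta] and 1 have equal [n]-th powers, so [Delta] is conjugate to 1. Then 1 is the
    only simple element, and [M] and [G] are trivial, against [g <> 1]. *)
Lemma Delta_torsion_free (g : G) (n : nat) :
  g <> 1 -> 0 < n -> Delta ^+ n <> 1.
Proof.
case: gM fracG => _ _ [[_ anti _ _ _] _] [_ _ gen] [iI frac] g1 n_gt0 Dn.
have D1 : Delta0 = 1.
  apply: iI; rewrite gmulf1; apply: conjugate_central; last first.
    by apply: (@root_of_Delta_power_eq _ 0 n n_gt0); rewrite /= Dn expg1n.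
  by move=> x; apply/commute_sym/commute1.
have M1 (a : M) : a = 1.
  have [s sS <-] := gen a; rewrite big_seq big1 // => x /sS[x1 xD].
  by apply: anti x1; rewrite -D1.
by apply: g1; have [a [b ->]] := frac g; rewrite (M1 a) (M1 b) mulVg.
Qed.

Lemma zexpg_Delta_inj (g : G) : g <> 1 -> injective (zexpg Delta).
Proof.
move=> g1 a b ab.
have : zexpg Delta (a - b)%R = 1 by rewrite zexpgD -zexpgV ab mulgV.
move=> E; apply/eqP; rewrite -subr_eq0; case: (a - b)%R E => [[|k]|k] //= E.
  by case: (Delta_torsion_free g1 (ltn0Sn k)).
by case: (Delta_torsion_free g1 (ltn0Sn k)); apply: invg_inj; rewrite E invg1.
Qed.

End Garside.

(** * Periodic elements *)

Section Periodic.
Variables (G : groupType) (Delta : G).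
Hypothesis hG : garside_group Delta.

Lemma garside_conjugate_root h (n : int) (k : nat) :
    0 < k -> conjugate (h ^+ k) (zexpg Delta (n * k)%R) ->
  conjugate h (zexpg Delta n).
Proof.
by case: hG => M [D [iota [gM fracG ->]]]; apply: conjugate_Delta_root.
Qed.

Lemma garside_zexpg_inj (g : G) : g <> 1 -> injective (zexpg Delta).
Proof.
by case: hG => M [D [iota [gM fracG ->]]]; apply: zexpg_Delta_inj.
Qed.

Variables (m : nat) (mP : minimal_central_power Delta m).
Variables (g : G) (p : int) (q : nat).
Hypotheses (g1 : g <> 1) (hg : periodic Delta g p q).

Let DeltaI := garside_zexpg_inj g1.
Let q_neq0 : Posz q != 0%R.
Proof. by case: hg; rewrite -lt0n. Qed.
Let m_neq0 : Posz m != 0%R.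
Proof. by case: mP; rewrite -lt0n. Qed.

Lemma central_Delta_mulz (n : int) : central (zexpg Delta (Posz m * n)%R).
Proof. by rewrite zexpgM; apply/central_zexpg/(mcp_central mP). Qed.

(** After raising to the power [m] both targets are central, so conjugacy becomes equality. *)
Lemma conjugate_Delta_inj x (a b : int) :
  conjugate x (zexpg Delta a) -> conjugate x (zexpg Delta b) -> a = b.
Proof.
move=> /(conjugate_zexpg m); rewrite -zexpgM mulrC.
move=> /(conjugate_central (central_Delta_mulz a)) xa.
move=> /(conjugate_zexpg m); rewrite -zexpgM mulrC.
move=> /(conjugate_central (central_Delta_mulz b)); rewrite xa.
by move/DeltaI/(mulfI m_neq0).
Qed.

(** With [d] the gcd, extracting a [d]-th root makes [g ^+ (q %/ d)] conjugate to a power of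
    [Delta]; minimality of [q] forces [d = 1]. *)
Lemma periodic_coprime : coprimez p q.
Proof.
case: hg => q_gt0 gq qmin; pose d := gcdn `|p| q.
have d_gt0 : 0 < d by rewrite gcdn_gt0 q_gt0 orbT.
have dq : (d %| q)%N by apply: dvdn_gcdr.
have /dvdzP[p' pE] : (d %| p)%Z by apply: dvdn_gcdl.
have : q <= q %/ d.
  apply: qmin; first by rewrite divn_gt0 // dvdn_leq.
  exists p'; apply: (garside_conjugate_root d_gt0).
  by rewrite -pE -expgnA divnK.
rewrite leq_divRL // -[leqRHS]muln1 leq_pmul2l // => d1.
by rewrite /coprimez /gcdz -/d eqz_nat eqn_leq d1.
Qed.

(** Forwards, compare two expressions for the [q]-th power of [zexpg g k]. Backwards, coprimality of
    [p] and [q] gives [k = j * q], hence [n = p * j]. *)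
Lemma conjugate_zexpg_DeltaP (k n : int) :
  conjugate (zexpg g k) (zexpg Delta n) <-> (n * q = p * k)%R.
Proof.
case: hg => _ gq _; split=> [gk|E].
  have := conjugate_zexpg (Posz q) gk; rewrite -!zexpgM => gkq.
  apply: conjugate_Delta_inj gkq _.
  by rewrite mulrC !zexpgM; apply: conjugate_zexpg.
have /dvdzP[j kE] : (q %| k)%Z.
  have <- := Gauss_dvdzr k (etrans (coprimez_sym q p) periodic_coprime).
  by rewrite -E dvdz_mull.
have -> : n = (p * j)%R by apply: (mulIf q_neq0); rewrite E kE mulrA.
by rewrite kE mulrC !zexpgM; apply: conjugate_zexpg.
Qed.

Notation N := (q * (m %/ gcdn `|p| m))%N.

(** As powers of [Delta ^+ m] are central, membership means [m * n * q = p * k] for some [n], that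
    is, [m * q] divides [p * k]. Cancel [d] on both sides, then [p' = p / d], which is prime to
    [m %/ d] and to [q]. *)
Lemma cyclic_DeltamP (k : int) :
  cyclic_subgroup (Delta ^+ m) (zexpg g k) <-> (N %| k)%Z.
Proof.
pose d := gcdn `|p| m.
have m_gt0 : 0 < m by case: mP.
have d_gt0 : 0 < d by rewrite gcdn_gt0 m_gt0 orbT.
have /dvdzP[p' pE] : (d %| p)%Z by apply: dvdn_gcdl.
have mE : m = (m %/ d * d)%N by rewrite divnK ?dvdn_gcdr.
have d0 : Posz d != 0%R by rewrite -lt0n.
have p'm' : coprimez p' (m %/ d)%N.
  have : (d * gcdn `|p'| (m %/ d) = d * 1)%N.
    rewrite muln_gcdr muln1 mulnC -[X in gcdn (_ * X)]/`|d|%N -abszM -pE.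
    by rewrite [(d * _)%N]mulnC -mE.
  by move=> /eqP; rewrite eqn_pmul2l // /coprimez /gcdz eqz_nat.
have p'q : coprimez p' q.
  by have := periodic_coprime; rewrite {1}pE coprimezMl => /andP[].
have -> : (N %| k)%Z = ((Posz m * Posz q)%R %| (p * k)%R)%Z.
  have -> : (Posz m * Posz q = d%:Z * ((m %/ d)%N%:Z * q%:Z))%R.
    by rewrite {1}mE PoszM [RHS]mulrCA mulrA.
  have -> : (p * k = d%:Z * (p' * k))%R by rewrite {1}pE mulrAC mulrC.
  rewrite dvdz_mul2l // Gauss_dvdzr -/d; first by rewrite PoszM mulrC.
  by rewrite coprimez_sym coprimezMr p'm'.
split=> [[n gk]|/dvdzP[n E]].
  have : conjugate (zexpg g k) (zexpg Delta (Posz m * n)%R).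
    by rewrite gk zexpgM; exists 1; rewrite conjg1.
  by move/conjugate_zexpg_DeltaP <-; rewrite mulrAC dvdz_mulr.
exists n; rewrite -[Delta ^+ m]/(zexpg Delta m) -zexpgM.
apply/(conjugate_central (central_Delta_mulz n))/conjugate_zexpg_DeltaP.
by rewrite E [RHS]mulrCA mulrA.
Qed.

Lemma bar_zexpg x (r : int) : bar mP (zexpg x r) = zexpg (bar mP x) r.
Proof.
elim/int_rect: r => [//|r IH|r IH].
  by rewrite -addn1 PoszD !zexpgS -IH; apply: quot_piM.
rewrite -addn1 PoszD opprD !zexpgB1 -IH.
by rewrite [LHS]quot_piM [quot_pi _ _^-1]quot_piV.
Qed.

(** Since [N] is the order of [bar mP g], recovering it from its [r]-th power amounts to a Bezout
    relation between [r] and [N]. *)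
Lemma cyclic_bar_zexpgP (r : int) :
  cyclic_subgroup (bar mP g) = cyclic_subgroup (bar mP (zexpg g r)) <->
  coprimez r N.
Proof.
have barP s : bar mP g = zexpg (bar mP g) (r * s)%R <-> (N %| (r * s - 1)%R)%Z.
  rewrite -bar_zexpg /bar quot_piP.
  have -> : g^-1 * zexpg g (r * s)%R = zexpg g (r * s - 1)%R.
    by rewrite addrC zexpgD.
  exact: cyclic_DeltamP.
rewrite bar_zexpg cyclic_subgroup_zexpgP; split=> [[s /barP/dvdzP[w E]]|].
  apply/coprimezP; exists (s, - w)%R => /=.
  by rewrite mulNr -E opprB addrC mulrC subrK.
move=> /coprimezP[[u v] /= E]; exists u; apply/barP; apply/dvdzP.
by exists (- v)%R; rewrite -E [(r * u)%R]mulrC opprD addNKr mulNr.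
Qed.

Lemma slim_coprimeP (r : int) : coprimez r q ->
  slim Delta (zexpg g r) <-> (p * r = 1 %[mod q])%Z.
Proof.
move=> rq; have [q_gt0 _ qmin] := hg.
have grq : conjugate (zexpg g r ^+ q) (zexpg Delta (p * r)%R).
  rewrite -[_ ^+ q]/(zexpg (zexpg g r) q) -zexpgM.
  by apply/conjugate_zexpg_DeltaP; rewrite mulrA.
have q_le k : 0 < k -> (exists n, conjugate (zexpg g r ^+ k) (zexpg Delta n)) ->
    q <= k.
  move=> k_gt0 [n]; rewrite -[_ ^+ k]/(zexpg (zexpg g r) k) -zexpgM.
  move/conjugate_zexpg_DeltaP => E; apply: (@dvdn_leq q k) => //.
  have : (q %| (p * (r * k))%R)%Z by rewrite -E dvdz_mull.
  by rewrite !Gauss_dvdzr // coprimez_sym ?periodic_coprime.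
split=> [[p' [q' [[q'_gt0 grq' q'min] p'1]]]|pr1]; last first.
  by exists (p * r)%R, q; split.
(* [slim] allows any periodicity data, so uniqueness is needed: the denominators agree by
   minimality, then the numerators by [conjugate_Delta_inj]. *)
have qq' : q = q'.
  apply/eqP; rewrite eqn_leq q_le ?q'min //; [by exists (p * r)%R | by exists p'].
by rewrite -qq' in grq' p'1; rewrite (conjugate_Delta_inj grq grq').
Qed.

End Periodic.

Theorem lemma3p22 (G : groupType) (Delta : G) (hG : garside_group Delta)
    (m : nat) (mP : minimal_central_power Delta m)
    (g : G) (p : int) (q : nat)
    (hg1 : g <> 1%g) (hg : periodic Delta g p q) :
  (forall r : int,
     (slim Delta (zexpg g r) /\
      cyclic_subgroup (bar mP g) = cyclic_subgroup (bar mP (zexpg g r)))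
     <->
     ((p * r = 1 %[mod q])%Z /\ coprimez r (m %/ gcdn `|p|%N m)%N))
  /\
  (exists r : int,
     slim Delta (zexpg g r) /\
     cyclic_subgroup (bar mP g) = cyclic_subgroup (bar mP (zexpg g r))).
Proof.
have equiv (r : int) : (slim Delta (zexpg g r) /\
      cyclic_subgroup (bar mP g) = cyclic_subgroup (bar mP (zexpg g r)))
     <-> ((p * r = 1 %[mod q])%Z /\ coprimez r (m %/ gcdn `|p|%N m)%N).
  rewrite (cyclic_bar_zexpgP hG mP hg1 hg) PoszM coprimezMr.
  split=> [[slim_gr /andP[rq ->]]|[pr1 ->]].
    by split=> //; apply/(slim_coprimeP hG mP hg1 hg rq).
  have rq : coprimez r q.
    have /eqP := pr1; rewrite eqz_mod_dvd => /dvdzP[w E].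
    apply/coprimezP; exists (p, - w)%R => /=.
    by rewrite mulNr -E opprB addrC subrK.
  by rewrite rq; split=> //; apply/(slim_coprimeP hG mP hg1 hg rq).
split=> //; have m_gt0 := mcp_gt0 mP; have [q_gt0 _ _] := hg.
have m'_gt0 : 0 < m %/ gcdn `|p| m.
  by rewrite divn_gt0 ?gcdn_gt0 ?m_gt0 ?orbT // dvdn_leq ?dvdn_gcdr.
have [r r_ok] := coprime_inverse_mod q_gt0 m'_gt0
  (periodic_coprime hG hg).
by exists r; apply/equiv.
Qed.
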